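(* Let $\delta\in(0,1)$, $\eta>0$, $t>0$. Let $\mathbf x_\star\in\mathbb C^N$ with $\|\mathbf x_\star\|_2=1$, and let $\mathbf a_0\in\mathbb C^N\setminus\{\mathbf 0\}$ be such that $\mathbf a_0^*\mathbf x_\star$ is a positive real number and $|\mathbf a_0^*\mathbf x_\star|\ge\delta\|\mathbf a_0\|_2\|\mathbf x_\star\|_2$. Define $$\mathcal R_\delta=\left\{\mathbf h\in\mathbb C^N:\ \big\|\mathbf h-(\mathbf x_\star^*\mathbf h)\mathbf x_\star\big\|_2\ge\delta\,\big|\mathrm{Im}(\mathbf x_\star^*\mathbf h)\big|\right\},$$ $$\mathcal C'_\delta=\left\{\mathbf z\in\mathbb C^N:\ \delta\langle\mathbf x_\star,\mathbf z\rangle\ge-\sqrt{1-\delta^2}\sqrt{\|\mathbf z\|_2^2-|\mathbf x_\star^*\mathbf z|^2}\right\}.$$ Let $\mathbf a$ be a random vector in $\mathbb C^N$ such that $$\inf_{\substack{\mathbf h\in\mathcal C'_\delta\cap\mathcal R_\delta\\ \|\mathbf h\|_2>(t\eta)^{-1}}}\ \mathbb P\Big(\langle\mathbf a\mathbf a^*\mathbf x_\star,\mathbf h\rangle>\tfrac12\eta^{-1}\Big)\ge p_{\min}$$ for some constant $p_{\min}\in(0,1)$ (depending only on $\delta$ and $t$). Let $\mathbf a_1,\dots,\mathbf a_M$ be i.i.d. copies of $\mathbf a$ and let $b_i=|\mathbf a_i^*\mathbf x_\star|^2+\xi_i$ with noise $\xi_1,\dots,\xi_M\in[0,\eta^{-1}]$.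 Then there is a constant $C>0$ depending only on $p_{\min}$ (and decreasing in $p_{\min}$) such that for every $\varepsilon\in(0,1)$, if $M\ge C\,(N+\log(1/\varepsilon))$, then with probability at least $1-\varepsilon$ every solution $\widehat{\mathbf x}$ of $$\max_{\mathbf x\in\mathbb C^N}\ \langle\mathbf a_0,\mathbf x\rangle\quad\text{subject to}\quad|\mathbf a_i^*\mathbf x|^2\le b_i,\ 1\le i\le M,$$ satisfies $\|\widehat{\mathbf x}-\mathbf x_\star\|_2\le(t\eta)^{-1}$.
   Context: $\mathbb C^N$ is regarded as a $2N$-dimensional real inner-product space with inner product $\langle\mathbf x_1,\mathbf x_2\rangle=\mathrm{Re}(\mathbf x_1^*\mathbf x_2)$. $\mathbf x^*$ denotes the conjugate transpose. *)

(* Defs.v *)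
From HB Require Import structures.
From mathcomp Require Import all_boot all_order all_algebra.
From mathcomp Require Import all_classical all_reals all_analysis.
From mathcomp Require Import complex.
Set Implicit Arguments. Unset Strict Implicit. Unset Printing Implicit Defensive.
Import Order.TTheory GRing.Theory Num.Theory.
Local Open Scope classical_set_scope.
Local Open Scope ring_scope.

Section Defs.
Variable R : realType.

Notation vec N := 'cV[R[i]]_N.

Definition adj N (x : vec N) : 'rV[R[i]]_N := (map_mx Num.conj x)^T.

Definition cdot N (x y : vec N) : R[i] := (adj x *m y) 0 0.

Definition rinner N (x y : vec N) : R := complex.Re (cdot x y).

Definition cmod (z : R[i]) : R := Num.sqrt (complex.Re z ^+ 2 + complex.Im z ^+ 2).

Definition norm2 N (x : vec N) : R :=
  Num.sqrt (\sum_(k < N) (complex.Re (x k 0) ^+ 2 + complex.Im (x k 0) ^+ 2)).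

Definition Rset N (delta : R) (xs : vec N) : set (vec N) :=
  [set h | delta * `|complex.Im (cdot xs h)| <= norm2 (h - cdot xs h *: xs)].

Definition Cset N (delta : R) (xs : vec N) : set (vec N) :=
  [set z | - (Num.sqrt (1 - delta ^+ 2) * Num.sqrt (norm2 z ^+ 2 - cmod (cdot xs z) ^+ 2))
           <= delta * rinner xs z].

(* the sigma-algebra on C^N generated by the real and imaginary parts of the
   coordinates (i.e. the Borel sigma-algebra of C^N = R^(2N)) *)
Definition vec_sets N : set (set (vec N)) :=
  <<s [set: vec N],
      [set S | exists k : 'I_N, exists B : set R, measurable B /\
         (S = (fun v : vec N => complex.Re (v k 0)) @^-1` B \/
          S = (fun v : vec N => complex.Im (v k 0)) @^-1` B)] >>.

Definition random_vec d (T : measurableType d) N (X : T -> vec N) : Prop :=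
  forall B, vec_sets B -> measurable (X @^-1` B).

Definition same_law d (T : measurableType d) (P : probability T R) N
  (X Y : T -> vec N) : Prop :=
  forall B, vec_sets B -> P (X @^-1` B) = P (Y @^-1` B).

Definition mutually_indep d (T : measurableType d) (P : probability T R) N M
  (X : 'I_M -> T -> vec N) : Prop :=
  forall (J : {set 'I_M}) (B : 'I_M -> set (vec N)),
    (forall i, vec_sets (B i)) ->
    P (\bigcap_(i in [set i | i \in J]) (X i @^-1` B i)) =
    (\prod_(i in J) P (X i @^-1` B i))%E.

Definition feasible N M (A : 'I_M -> vec N) (b : 'I_M -> R) (x : vec N) : Prop :=
  forall i, cmod (cdot (A i) x) ^+ 2 <= b i.

Definition is_solution N M (a0 : vec N) (A : 'I_M -> vec N) (b : 'I_M -> R)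
  (x : vec N) : Prop :=
  feasible A b x /\ forall y, feasible A b y -> rinner a0 y <= rinner a0 x.

End Defs.

(* Main.v *)
Require Import Defs.
From HB Require Import structures.
From mathcomp Require Import all_boot all_order all_algebra.
From mathcomp Require Import all_classical all_reals all_analysis.
From mathcomp Require Import measurable_realfun complex.
From mathcomp Require Import ring lra.
Set Implicit Arguments. Unset Strict Implicit. Unset Printing Implicit Defensive.
Import Order.TTheory GRing.Theory Num.Theory.
Local Open Scope ring_scope.

(* The error h = xhat - xs of a solution lies in both cones (feasibility of xs and
   of the phase rotations of xhat) and satisfies <a_i a_i^* xs, h> <= 1/(2 eta) for
   all i.  So it suffices to bound the probability that M independent samples all
   miss some half-space of probability at least p.  Half-spaces in R^(2N) have
   Vapnik-Chervonenkis dimension at most 2N, and a weighted double-sampling argument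
   bounds this probability by (number of traces on 2M points) (1 + p)^-M.  All of it
   is done for finite families of half-spaces, where only the law of the random
   pattern {j : the sample misses the j-th half-space} matters; a countable dense
   family then suffices. *)

(** * Shattering *)

Definition shattered (T : finType) (F : {set {set T}}) (A : {set T}) : bool :=
  [forall B : {set T}, (B \subset A) ==> [exists S in F, S :&: A == B]].

Lemma shatteredP (T : finType) (F : {set {set T}}) (A : {set T}) :
  reflect (forall B : {set T}, B \subset A -> exists2 S : {set T}, S \in F & S :&: A = B)
          (shattered F A).
Proof.
apply: (iffP forallP) => [H B sBA|H B].
  by have /implyP/(_ sBA)/exists_inP[S FS /eqP] := H B; exists S.
by apply/implyP => /H[S FS SA]; apply/exists_inP; exists S => //; apply/eqP.
Qed.

Lemma shatteredS (T : finType) (F G : {set {set T}}) (A : {set T}) :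
  F \subset G -> shattered F A -> shattered G A.
Proof.
move=> sFG /shatteredP FA; apply/shatteredP => B /FA[S FS SA].
by exists S => //; apply: (fintype.subsetP sFG).
Qed.

(* Pajor's form of the Sauer-Shelah lemma. *)
Lemma card_le_shattered (T : finType) (F : {set {set T}}) :
  (#|F| <= #|[set A | shattered F A]|)%N.
Proof.
have [n] := ubnP #|F|; elim: n F => // n IHn F; rewrite ltnS => leFn.
have [Fle1|/card_gt1P[S1 [S2 [FS1 FS2 neqS]]]] := leqP #|F| 1.
  have [->|[S FS]] := set_0Vmem F; first by rewrite cards0.
  apply: leq_trans Fle1 _; rewrite card_gt0; apply/set0Pn; exists finset.set0.
  rewrite inE; apply/shatteredP => B; rewrite finset.subset0 => /eqP->.
  by exists S => //; rewrite finset.setI0.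
(* A point [x] separating two members splits [F] into two nonempty, hence strictly smaller,
   families, to which the induction applies. *)
have [x neqx] : exists x, (x \in S1) != (x \in S2).
  apply/existsP; rewrite -negb_forall; apply: contra neqS => /forallP H.
  by apply/eqP/finset.setP => x; apply/eqP/H.
pose F1 := [set S in F | x \in S]; pose F0 := [set S in F | x \notin S].
have cardF : #|F| = (#|F0| + #|F1|)%N.
  rewrite addnC -(cardsID [set S : {set T} | x \in S] F); congr addn.
    by apply: eq_card => S; rewrite !inE.
  by apply: eq_card => S; rewrite !inE andbC.
have sF0 : F0 \subset F by apply/fintype.subsetP => S; rewrite inE => /andP[].
have sF1 : F1 \subset F by apply/fintype.subsetP => S; rewrite inE => /andP[].
have [F0gt0 F1gt0] : (0 < #|F0|)%N /\ (0 < #|F1|)%N.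
  by split; rewrite card_gt0; apply/set0Pn; move: neqx;
     case S1x: (x \in S1); case S2x: (x \in S2) => // _;
     do [by exists S1; rewrite inE FS1 S1x | by exists S2; rewrite inE FS2 S2x].
have ltF0 : (#|F0| < n)%N by rewrite (leq_trans _ leFn)// cardF -addn1 leq_add2l.
have ltF1 : (#|F1| < n)%N by rewrite (leq_trans _ leFn)// cardF -add1n leq_add2r.
rewrite cardF (leq_trans (leq_add (IHn _ ltF0) (IHn _ ltF1)))//.
set H0 := [set A | shattered F0 A]; set H1 := [set A | shattered F1 A].
have nx0 A : A \in H0 -> x \notin A.
  rewrite inE => /shatteredP/(_ A (subxx _))[S]; rewrite inE => /andP[_ nSx] <-.
  by rewrite inE negb_and nSx.
have nx1 A : A \in H1 -> x \notin A.
  rewrite inE => /shatteredP/(_ finset.set0 (finset.sub0set _))[S].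
  rewrite inE => /andP[_ Sx] e.
  by apply/negP => Ax; have /finset.setP/(_ x) := e; rewrite !inE Sx Ax.
(* Sets shattered by both halves are counted twice. The second count is charged to [x |: A], which
   [F] also shatters and which is new because it contains [x]. *)
rewrite -cardsUI.
have -> : #|H0 :&: H1| = #|[set x |: A | A in H0 :&: H1]|.
  rewrite card_in_imset// => A B /setIP[/nx0 nA _] /setIP[/nx0 nB _] e.
  by rewrite -(setU1K nA) -(setU1K nB) e.
set H2 := [set x |: A | A in _].
have H02 : (H0 :|: H1) :&: H2 = finset.set0.
  apply/finset.setP => A; rewrite inE [RHS]inE; apply/negbTE.
  apply/negP => /andP[/setUP HA /imsetP[B _ AB]].
  suff : x \notin A by rewrite AB !inE eqxx.
  by case: HA => [/nx0|/nx1].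
have <- : #|(H0 :|: H1) :|: H2| = (#|H0 :|: H1| + #|H2|)%N.
  by rewrite cardsU H02 cards0 subn0.
apply/subset_leq_card/fintype.subsetP => A /setUP[/setUP[]|/imsetP[B /setIP[]]].
- by rewrite !inE; exact: shatteredS.
- by rewrite !inE; exact: shatteredS.
move=> H0B H1B ->; have nxB := nx0 _ H0B.
move: H0B H1B; rewrite !inE => /shatteredP B0 /shatteredP B1.
apply/shatteredP => B' sB'.
have sD : B' :\ x \subset B by rewrite finset.subDset.
(* The half of [F] that realizes [B'] is dictated by whether [x] lies in [B']. *)
have [xB'|nxB'] := boolP (x \in B').
  have [S] := B1 _ sD; rewrite inE => /andP[FS Sx] SB; exists S => //.
  by rewrite finset.setIUr SB (finset.setIidPr _) ?finset.sub1set// finset.setD1K.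
have [S] := B0 _ sD; rewrite inE => /andP[FS nSx] SB; exists S => //.
rewrite finset.setIUr SB (_ : S :&: [set x]%SET = finset.set0) ?finset.set0U.
  by apply/finset.setDidPl; rewrite disjoint_sym disjoints1.
apply/finset.setP => y; rewrite !inE; apply/negbTE.
by apply: contra nSx => /andP[yS /eqP<-].
Qed.

(** The right side expands as the sum of [th ^+ #|A|] over all subsets [A]. Each shattered [A]
    contributes at least [th ^+ D], and there are at least [#|F|] of them. The parameter [th] stays
    free, to be tuned against the decay rate. *)
Lemma card_family_le (R : realFieldType) (T : finType) (F : {set {set T}})
    (D : nat) (th : R) :
  0 < th <= 1 -> (forall A, shattered F A -> (#|A| <= D)%N) ->
  th ^+ D * #|F|%:R <= (1 + th) ^+ #|T|.
Proof.
move=> /andP[th0 th1] FD.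
have -> : (1 + th) ^+ #|T| = \sum_(A : {set T}) th ^+ #|A|.
  rewrite addrC -prodr_const (bigA_distr _ _ (fun=> th) (fun=> 1)).
  by apply: eq_bigr => A _; rewrite -big_mkcond prodr_const.
apply: (@le_trans _ _ (\sum_(A | shattered F A) th ^+ D)).
  rewrite sumr_const -[leRHS]mulr_natr ler_wpM2l ?exprn_ge0 ?(ltW th0)//.
  by rewrite ler_nat (leq_trans (card_le_shattered F))// cardsE.
rewrite big_mkcond ler_sum// => A _; case: ifP => [/FD AD|_].
  by rewrite ler_wiXn2l// (ltW th0).
by rewrite exprn_ge0// ltW.
Qed.

(* A shattered set of more than D points carries a nontrivial linear relation
   among the points; normalized so that its coefficients have a nonpositive sum,
   it contradicts the pattern selecting exactly its positive coefficients. *)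
Lemma shattered_halfspaces (R : realFieldType) (D : nat) (T J : finType)
    (u : T -> 'rV[R]_D) (v : J -> 'rV[R]_D) (c : R) (A : {set T}) : 0 <= c ->
  shattered [set [set i | (u i *m (v j)^T) 0 0 <= c] | j : J] A ->
  (#|A| <= D)%N.
Proof.
move=> c0 /shatteredP shA; rewrite leqNgt; apply/negP => ltDA.
(* The rows of [Y] are the points of [A]; more rows than columns force a linear relation. *)
pose Y : 'M[R]_(#|A|, D) := \matrix_(k < #|A|) u (enum_val k).
have kerY : kermx Y != 0.
  by rewrite kermx_eq0 /row_free neq_ltn (leq_ltn_trans (rank_leq_col Y)).
have [l0 l0ker l0n0] := rowV0Pn kerY.
have [l [lY ln0 lsum]] : exists l : 'rV[R]_#|A|,
    [/\ l *m Y = 0, l != 0 & \sum_k l 0 k <= 0].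
  have H := sub_kermxP l0ker; have [?|?] := leP (\sum_k l0 0 k) 0.
    by exists l0.
  exists (- l0); split; rewrite ?oppr_eq0 ?mulNmx ?H ?oppr0//.
  under eq_bigr do rewrite mxE.
  by rewrite sumrN oppr_le0 ltW.
have [k0 lk0] : exists k, l 0 k < 0.
  apply/existsP; apply: contraT; rewrite negb_exists => /forallP lge0.
  have l_ge0 k : 0 <= l 0 k by rewrite leNgt.
  case/eqP: ln0; apply/rowP => k; rewrite mxE; apply: le_anti.
  rewrite l_ge0 andbT (le_trans _ lsum)// (bigD1 k)//= lerDl.
  exact: sumr_ge0.
have sP : [set enum_val k | k in [pred k | 0 < l 0 k]]%SET \subset A.
  by apply/fintype.subsetP => _ /imsetP[k _ ->]; exact: enum_valP.
have [_ /imsetP[j _ ->] jP] := shA _ sP.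
have {}jP k : ((u (enum_val k) *m (v j)^T) 0 0 <= c) = (0 < l 0 k).
  have /finset.setP/(_ (enum_val k)) := jP; rewrite !inE enum_valP andbT => ->.
  by rewrite finset.mem_imset ?inE//; exact: enum_val_inj.
have lin : \sum_k l 0 k * (u (enum_val k) *m (v j)^T) 0 0 = 0.
  transitivity ((l *m Y *m (v j)^T) 0 0); last by rewrite lY mul0mx mxE.
  rewrite -mulmxA mxE; apply: eq_bigr => k _; congr (_ * _).
  by rewrite !mxE; apply: eq_bigr => i _; rewrite !mxE.
(* By the choice of pattern each term is nonpositive, and the [k0] term is negative. Yet by
   linearity the sum is [- c] times the sum of the [l 0 k], which is nonnegative. *)
have : \sum_k l 0 k * ((u (enum_val k) *m (v j)^T) 0 0 - c) < 0.
  rewrite (bigD1 k0)//= ltr_wnDr//.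
    apply: sumr_le0 => k _; have := jP k; have [lk|lk|lk] := ltgtP 0 (l 0 k).
    - by move=> H; rewrite mulr_ge0_le0// ?subr_le0 ?H ?ltW.
    - by move/negbT; rewrite -ltNge => H; rewrite mulr_le0_ge0// ?subr_ge0 ltW.
    - by rewrite -lk mul0r.
  by rewrite nmulr_rlt0// subr_gt0 ltNge jP -leNgt ltW.
under eq_bigr do rewrite mulrBr.
rewrite sumrB lin sub0r oppr_lt0 -mulr_suml ltNge => /negP; apply.
by rewrite mulr_le0_ge0.
Qed.

(** * Double sampling *)

(** [J] indexes the half-spaces and [z i] is the set of those missed by the [i]-th point; a trace
    collects the points that miss one given half-space. *)
Definition traces (I J : finType) (z : {ffun I -> {set J}}) : {set {set I}} :=
  [set [set i | j \in z i] | j : J].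

(* A sample of size M and a ghost sample of size M are indexed together by
   'I_M * bool.  A trace lying fully above the true sample is weighted by 2 to
   the number of ghost points it misses: this has mean (1 + p)^M at least over
   the ghost sample, and mean 1 at most over the swaps of the two samples. *)
Definition ghost_weight (R : pzSemiRingType) (M : nat) (t : {set 'I_M * bool}) : R :=
  \prod_i (((i, false) \in t)%:R * (if (i, true) \in t then 1 else 2)).

Definition swap (M : nat) (s : {ffun 'I_M -> bool}) (i : 'I_M * bool) :
  'I_M * bool := (i.1, i.2 (+) s i.1).

Lemma swapK (M : nat) (s : {ffun 'I_M -> bool}) : involutive (swap s).
Proof. by case=> i b; rewrite /swap/= addbK. Qed.

(** The sum factors over positions, and each factor is at most 2: it is 1 + 1 if both points of the
    pair lie in [t], 2 + 0 if only one does, and 0 otherwise. *)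
Lemma sum_ghost_weight (R : realFieldType) (M : nat) (t : {set 'I_M * bool}) :
  \sum_s ghost_weight R (swap s @^-1: t) <= 2 ^+ M.
Proof.
pose g i b : R := ((i, b) \in t)%:R * (if (i, ~~ b) \in t then 1 else 2).
have -> : \sum_s ghost_weight R (swap s @^-1: t) =
    \sum_(s : {ffun 'I_M -> bool}) \prod_i g i (s i).
  apply: eq_bigr => s _; apply: eq_bigr => i _.
  by rewrite !inE /swap/= /g; case: (s i).
rewrite -bigA_distr_bigA/= (le_trans (y := \prod_(i < M) 2))//; last first.
  by rewrite prodr_const card_ord.
apply: ler_prod => i _; rewrite big_bool/= /g.
by do 2!case: (_ \in t) => /=; rewrite ?mul0r ?mulr0 ?mul1r ?mulr1; lra.
Qed.

Lemma traces_swap (M : nat) (J : finType) (z : {ffun 'I_M * bool -> {set J}})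
    (s : {ffun 'I_M -> bool}) (t : {set 'I_M * bool}) :
  (swap s @^-1: t \in traces [ffun i => z (swap s i)]) = (t \in traces z).
Proof.
apply/imsetP/imsetP => -[j _ tj]; exists j => //.
  apply/finset.setP => i; have /finset.setP/(_ (swap s i)) := tj.
  by rewrite !inE ffunE swapK.
by apply/finset.setP => i; rewrite tj !inE ffunE.
Qed.

(** Both bounds concern [W], the mean total weight of the traces of 2M independent points. From
    below, a true sample missing the [j]-th half-space gives the trace of [j] a ghost mean of at
    least [(1 + p) ^+ M]. From above, [W] is invariant under swaps, and averaging over them leaves
    at most the number of traces. *)
Lemma double_sample_bound (R : realFieldType) (J : finType) (M : nat)
    (mu : {set J} -> R) (p Q : R) :
  (forall s, 0 <= mu s) -> \sum_s mu s = 1 -> 0 <= p ->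
  (forall j : J, p <= \sum_(s : {set J} | j \notin s) mu s) ->
  (forall z : {ffun 'I_M * bool -> {set J}},
     (forall i, 0 < mu (z i)) -> #|traces z|%:R <= Q) ->
  (1 + p) ^+ M *
    \sum_(s : {ffun 'I_M -> {set J}} | [exists j, forall i, j \in (s i : {set J})])
      \prod_i mu (s i) <= Q.
Proof.
move=> mu0 mu1 p0 pmu Qtr.
have muF0 (I : finType) (z : {ffun I -> {set J}}) : 0 <= \prod_i mu (z i).
  exact: prodr_ge0.
have w0 t : 0 <= ghost_weight R t :> R.
  apply: prodr_ge0 => i _; rewrite mulr_ge0//.
  by case: ifP.
pose W := \sum_(z : {ffun 'I_M * bool -> {set J}})
  \prod_i mu (z i) * \sum_(t in traces z) ghost_weight R t.
apply: (@le_trans _ _ W).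
  pose glue (ss : {ffun 'I_M -> {set J}} * {ffun 'I_M -> {set J}}) :=
    [ffun i : 'I_M * bool => if i.2 then ss.2 i.1 else ss.1 i.1].
  pose unglue (z : {ffun 'I_M * bool -> {set J}}) :=
    ([ffun i => z (i, false)], [ffun i => z (i, true)]).
  have glueK : cancel glue unglue.
    by move=> [s s']; congr (_, _); apply/ffunP => i; rewrite !ffunE.
  have unglueK : cancel unglue glue.
    by move=> z; apply/ffunP => -[i []]; rewrite !ffunE.
  rewrite /W (reindex glue)/=; last by exists unglue => ? _.
  rewrite -(pair_bigA _ (fun s s' => \prod_i mu (glue (s, s') i) *
    \sum_(t in traces (glue (s, s'))) ghost_weight R t))/=.
  rewrite mulr_sumr big_mkcond/= ler_sum// => s _.
  have -> : \sum_s' \prod_i mu (glue (s, s') i) *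
      (\sum_(t in traces (glue (s, s'))) ghost_weight R t) =
    (\prod_i mu (s i)) * \sum_(s' : {ffun 'I_M -> {set J}}) (\prod_i mu (s' i)) *
      (\sum_(t in traces (glue (s, s'))) ghost_weight R t).
    rewrite mulr_sumr; apply: eq_bigr => s' _; rewrite mulrA; congr (_ * _).
    transitivity (\prod_(i : 'I_M * bool) mu (glue (s, s') (i.1, i.2))).
      by apply: eq_bigr => -[].
    rewrite -(pair_bigA _ (fun i b => mu (glue (s, s') (i, b))))/= -big_split/=.
    by apply: eq_bigr => i _; rewrite big_bool/= !ffunE/= mulrC.
  case: ifPn => [/existsP[j /forallP js]|_]; last first.
    rewrite mulr_ge0// sumr_ge0// => s' _; rewrite mulr_ge0// sumr_ge0//.
  rewrite mulrC ler_wpM2l//.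
  (* [f] is the factor contributed by one ghost point; its mean is 1 plus the probability of
     [j \notin s'], hence at least [1 + p]. *)
  pose f (s' : {set J}) : R := if j \in s' then 1 else 2.
  apply: (@le_trans _ _ (\prod_(i < M) \sum_s' mu s' * f s')).
    rewrite -[M in X in X <= _]card_ord -prodr_const.
    apply: ler_prod => _ _; rewrite addr_ge0//=.
    rewrite -mu1 (bigID (fun s' : {set J} => j \in s'))/= -addrA.
    rewrite [leRHS](bigID (fun s' : {set J} => j \in s'))/= lerD//.
      by apply: ler_sum => s' js'; rewrite /f js' mulr1.
    rewrite (le_trans (lerD (lexx _) (pmu j)))// -big_split/=.
    by apply: ler_sum => s' /negbTE js'; rewrite /f js' mulr_natr mulr2n.
  rewrite bigA_distr_bigA/= ler_sum// => s' _.
  rewrite big_split/= ler_wpM2l//.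
  (* Among all traces only that of [j] is kept; the other weights are nonnegative. *)
  rewrite (bigD1 [set i | j \in glue (s, s') i]%SET)/=; last first.
    by apply/imsetP; exists j.
  rewrite -[leLHS]addr0 lerD ?sumr_ge0// /ghost_weight.
  by apply: ler_prod => i _; rewrite !inE !ffunE/= js mul1r /f lexx andbT; case: ifP.
(* The product law is exchangeable, and swapping the points turns traces into their preimages under
   the swap. *)
have WE s : W = \sum_(z : {ffun 'I_M * bool -> {set J}})
    \prod_i mu (z i) * \sum_(t in traces z) ghost_weight R (swap s @^-1: t).
  rewrite /W (reindex_inj (h := fun z : {ffun 'I_M * bool -> {set J}} =>
      [ffun i => z (swap s i)])); last first.
    move=> z z' /ffunP zz'; apply/ffunP => i.
    by have := zz' (swap s i); rewrite !ffunE swapK.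
  apply: eq_bigr => z _; congr (_ * _).
    rewrite [RHS](reindex_inj (inv_inj (swapK s))).
    by apply: eq_bigr => i _; rewrite ffunE.
  rewrite (reindex_inj (h := fun t : {set _} => swap s @^-1: t)); last first.
    move=> t t' /finset.setP tt'; apply/finset.setP => i.
    by have := tt' (swap s i); rewrite !inE swapK.
  by apply: eq_bigl => t; rewrite traces_swap.
have : 2 ^+ M * W <= 2 ^+ M * Q; last by rewrite ler_pM2l ?exprn_gt0.
have -> : 2 ^+ M * W = \sum_(s : {ffun 'I_M -> bool}) W.
  by rewrite sumr_const card_ffun card_bool card_ord -[RHS]mulr_natl natrX.
rewrite (eq_bigr _ (fun s _ => WE s)).
rewrite exchange_big/=.
apply: (@le_trans _ _ (\sum_(z : {ffun 'I_M * bool -> {set J}})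
    (\prod_i mu (z i)) * (2 ^+ M * Q))); last first.
  rewrite -mulr_suml -(bigA_distr_bigA (fun _ => mu))/=.
  by under eq_bigr do rewrite mu1; rewrite big1_eq mul1r.
apply: ler_sum => z _; rewrite -mulr_sumr exchange_big/=.
(* The bound [Q] covers only patterns of positive mass; a [z] with a null coordinate contributes
   0. *)
have [i mui|zpos] := pickP (fun i => mu (z i) <= 0).
  have mu_i0 : mu (z i) = 0 by apply/le_anti; rewrite mui mu0.
  by rewrite (bigD1 i)//= mu_i0 !mul0r.
rewrite ler_wpM2l//.
apply: (@le_trans _ _ (\sum_(t in traces z) 2 ^+ M)).
  by apply: ler_sum => t _; exact: sum_ghost_weight.
rewrite sumr_const -[leLHS]mulr_natr ler_wpM2l ?exprn_ge0// Qtr// => i.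
by rewrite ltNge zpos.
Qed.

(** * Geometry of the error *)

Lemma ReD (R : realType) (x y : R[i]) : complex.Re (x + y) = complex.Re x + complex.Re y.
Proof. by case: x; case: y. Qed.

Lemma ImD (R : realType) (x y : R[i]) : complex.Im (x + y) = complex.Im x + complex.Im y.
Proof. by case: x; case: y. Qed.

Lemma Re_sum (R : realType) (I : finType) (F : I -> R[i]) :
  complex.Re (\sum_i F i) = \sum_i complex.Re (F i).
Proof. exact: (big_morph _ (@ReD R)). Qed.

Lemma Im_sum (R : realType) (I : finType) (F : I -> R[i]) :
  complex.Im (\sum_i F i) = \sum_i complex.Im (F i).
Proof. exact: (big_morph _ (@ImD R)). Qed.

Lemma ReMc (R : realType) (x y : R[i]) :
  complex.Re (x * y) = complex.Re x * complex.Re y - complex.Im x * complex.Im y.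
Proof. by case: x; case: y. Qed.

Lemma ImMc (R : realType) (x y : R[i]) :
  complex.Im (x * y) = complex.Re x * complex.Im y + complex.Im x * complex.Re y.
Proof. by case: x; case: y. Qed.

Lemma Re_conj (R : realType) (x : R[i]) : complex.Re (Num.conj x) = complex.Re x.
Proof. by case: x. Qed.

Lemma Im_conj (R : realType) (x : R[i]) : complex.Im (Num.conj x) = - complex.Im x.
Proof. by case: x. Qed.

Lemma cdotE (R : realType) (N : nat) (x y : 'cV[R[i]]_N) :
  cdot x y = \sum_k Num.conj (x k 0) * y k 0.
Proof. by rewrite /cdot /adj mxE; apply: eq_bigr => k _; rewrite !mxE. Qed.

Lemma rinnerE (R : realType) (N : nat) (x y : 'cV[R[i]]_N) :
  rinner x y = \sum_k (complex.Re (x k 0) * complex.Re (y k 0) +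
                       complex.Im (x k 0) * complex.Im (y k 0)).
Proof.
rewrite /rinner cdotE Re_sum; apply: eq_bigr => k _.
by rewrite ReMc Re_conj Im_conj mulNr opprK.
Qed.

Lemma cdotDr (R : realType) (N : nat) (x y z : 'cV[R[i]]_N) :
  cdot x (y + z) = cdot x y + cdot x z.
Proof. by rewrite /cdot mulmxDr mxE. Qed.

Lemma cdotZr (R : realType) (N : nat) (c : R[i]) (x y : 'cV[R[i]]_N) :
  cdot x (c *: y) = c * cdot x y.
Proof. by rewrite /cdot -scalemxAr mxE. Qed.

Lemma cdotC (R : realType) (N : nat) (x y : 'cV[R[i]]_N) :
  cdot x y = Num.conj (cdot y x).
Proof.
rewrite !cdotE rmorph_sum; apply: eq_bigr => k _.
by rewrite rmorphM/= conjCK mulrC.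
Qed.

Lemma cdotZl (R : realType) (N : nat) (c : R[i]) (x y : 'cV[R[i]]_N) :
  cdot (c *: x) y = Num.conj c * cdot x y.
Proof. by rewrite cdotC cdotZr rmorphM/= -cdotC. Qed.

Lemma rinnerC (R : realType) (N : nat) (x y : 'cV[R[i]]_N) :
  rinner x y = rinner y x.
Proof. by rewrite /rinner cdotC Re_conj. Qed.

Lemma rinnerDr (R : realType) (N : nat) (x y z : 'cV[R[i]]_N) :
  rinner x (y + z) = rinner x y + rinner x z.
Proof. by rewrite /rinner cdotDr ReD. Qed.

Lemma rinnerZr (R : realType) (N : nat) (c : R) (x y : 'cV[R[i]]_N) :
  rinner x (c%:C%C *: y) = c * rinner x y.
Proof. by rewrite /rinner cdotZr ReMc/= mul0r subr0. Qed.

Lemma norm2_ge0 (R : realType) (N : nat) (x : 'cV[R[i]]_N) : 0 <= norm2 x.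
Proof. exact: sqrtr_ge0. Qed.

Lemma rinnerxx (R : realType) (N : nat) (x : 'cV[R[i]]_N) :
  rinner x x = norm2 x ^+ 2.
Proof.
rewrite rinnerE /norm2 sqr_sqrtr.
  by apply: eq_bigr => k _; rewrite !expr2.
by apply: sumr_ge0 => k _; rewrite addr_ge0 ?sqr_ge0.
Qed.

Lemma norm2D_sqr (R : realType) (N : nat) (x y : 'cV[R[i]]_N) :
  norm2 (x + y) ^+ 2 = norm2 x ^+ 2 + rinner x y *+ 2 + norm2 y ^+ 2.
Proof.
rewrite -!rinnerxx rinnerDr !(rinnerC (x + y)) !rinnerDr (rinnerC y x) mulr2n.
by rewrite !addrA.
Qed.

Lemma norm2Z (R : realType) (N : nat) (c : R[i]) (x : 'cV[R[i]]_N) :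
  norm2 (c *: x) = cmod c * norm2 x.
Proof.
rewrite /norm2 /cmod -sqrtrM ?addr_ge0 ?sqr_ge0//; congr Num.sqrt.
by rewrite mulr_sumr; apply: eq_bigr => k _; rewrite mxE ReMc ImMc; ring.
Qed.

Lemma norm2_eq0 (R : realType) (N : nat) (x : 'cV[R[i]]_N) :
  norm2 x = 0 -> x = 0.
Proof.
move=> /(congr1 (fun r => r ^+ 2)); rewrite -rinnerxx rinnerE expr0n/= => /eqP.
rewrite psumr_eq0 => [/allP x0|k _]; last by rewrite -!expr2 addr_ge0 ?sqr_ge0.
apply/matrixP => k j; rewrite ord1 mxE; have := x0 k (mem_index_enum _).
rewrite -!expr2 paddr_eq0 ?sqr_ge0// !sqrf_eq0; case: (x k 0) => a b /=.
by move=> /andP[/eqP-> /eqP->].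
Qed.

Lemma rinner_le (R : realType) (N : nat) (x y : 'cV[R[i]]_N) :
  rinner x y <= norm2 x * norm2 y.
Proof.
have rinner0 (z : 'cV[R[i]]_N) : rinner z 0 = 0.
  by rewrite rinnerE big1// => k _; rewrite mxE !mulr0 addr0.
have [/eqP|XY0] := eqVneq (norm2 x * norm2 y) 0.
  rewrite mulf_eq0 => /orP[] /eqP/norm2_eq0->; last first.
    by rewrite rinner0 mulr_ge0 ?norm2_ge0.
  by rewrite rinnerC rinner0 mulr_ge0 ?norm2_ge0.
have XYgt0 : 0 < norm2 x * norm2 y by rewrite lt_def XY0 mulr_ge0 ?norm2_ge0.
rewrite -(ler_pM2l XYgt0).
(* Expanding this square gives twice [norm2 x * norm2 y] times the desired difference. *)
have := sqr_ge0 (norm2 ((norm2 y)%:C%C *: x + (- norm2 x)%:C%C *: y)).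
rewrite norm2D_sqr !norm2Z /cmod/= expr0n/= !addr0 !sqrtr_sqr normrN.
rewrite !ger0_norm ?norm2_ge0// rinnerZr rinnerC rinnerZr rinnerC.
by rewrite mulr2n; lra.
Qed.

(** Cauchy-Schwarz for [x] multiplied by i or -i, whose real inner product with [y] is plus or minus
    the imaginary part. *)
Lemma Im_cdot_le (R : realType) (N : nat) (x y : 'cV[R[i]]_N) :
  `|complex.Im (cdot x y)| <= norm2 x * norm2 y.
Proof.
have iE (s : R) : s ^+ 2 = 1 -> s * complex.Im (cdot x y) <= norm2 x * norm2 y.
  move=> s2; have := rinner_le ((0 +i* s)%C *: x) y.
  rewrite norm2Z /cmod/= expr0n/= add0r s2 sqrtr1 mul1r.
  by rewrite /rinner cdotZl ReMc Re_conj Im_conj/= mul0r sub0r mulNr opprK.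
rewrite ler_norml lerNl -mulN1r iE ?sqrrN ?expr1n//=.
by rewrite -[leLHS]mul1r iE ?expr1n.
Qed.

(** * Expansion of a measurement and projection off [xs] *)

Lemma cmod_sqr (R : realType) (z : R[i]) :
  cmod z ^+ 2 = complex.Re z ^+ 2 + complex.Im z ^+ 2.
Proof. by rewrite sqr_sqrtr// addr_ge0 ?sqr_ge0. Qed.

Lemma rinner_measurement (R : realType) (N : nat) (a x h : 'cV[R[i]]_N) :
  rinner (a *m (adj a *m x)) h = complex.Re (Num.conj (cdot a x) * cdot a h).
Proof. by rewrite [adj a *m x]mx11_scalar mul_mx_scalar /rinner cdotZl. Qed.

Lemma cmod_cdotD_sqr (R : realType) (N : nat) (a x h : 'cV[R[i]]_N) :
  cmod (cdot a (x + h)) ^+ 2 = cmod (cdot a x) ^+ 2 +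
    2 * rinner (a *m (adj a *m x)) h + cmod (cdot a h) ^+ 2.
Proof.
rewrite cdotDr rinner_measurement !cmod_sqr ReD ImD ReMc Re_conj Im_conj; ring.
Qed.

Lemma norm2_perp_sqr (R : realType) (N : nat) (xs h : 'cV[R[i]]_N) :
  norm2 xs = 1 ->
  norm2 (h - cdot xs h *: xs) ^+ 2 = norm2 h ^+ 2 - cmod (cdot xs h) ^+ 2.
Proof.
move=> xs1; rewrite -scaleNr norm2D_sqr norm2Z xs1 mulr1.
rewrite [rinner h _]/rinner cdotZr [cdot h xs]cdotC.
rewrite ReMc Re_conj Im_conj !cmod_sqr.
case: (cdot xs h) => a b /=; rewrite mulr2n; lra.
Qed.

Lemma cdot_perp (R : realType) (N : nat) (xs h : 'cV[R[i]]_N) :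
  norm2 xs = 1 -> cdot xs (h - cdot xs h *: xs) = 0.
Proof.
move=> xs1; rewrite -scaleNr cdotDr cdotZr mulNr.
suff -> : cdot xs xs = 1 by rewrite mulr1 subrr.
have := rinnerxx xs; rewrite xs1 expr1n /rinner.
have : complex.Im (cdot xs xs) = 0.
  have /(congr1 (@complex.Im R)) := cdotC xs xs; rewrite Im_conj => ?; lra.
by case: (cdot xs xs) => a b /= -> ->.
Qed.

(** Write [h = g + b *: xs] with [g] orthogonal to [xs], so that [cdot a0 h] is [cdot a0 g] plus [b]
    times a real [al >= delta * norm2 a0]. Bounding [cdot a0 g] by Cauchy-Schwarz, the real part
    yields [Cset] and the vanishing imaginary part yields [Rset]. *)
Lemma error_in_cones (R : realType) (N : nat) (delta : R) (xs a0 h : 'cV[R[i]]_N) :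
  0 < delta < 1 -> norm2 xs = 1 -> a0 != 0 -> 0 < cdot a0 xs ->
  delta * norm2 a0 * norm2 xs <= cmod (cdot a0 xs) ->
  0 <= rinner a0 h -> complex.Im (cdot a0 h) = 0 ->
  Cset delta xs h /\ Rset delta xs h.
Proof.
move=> /andP[d0 d1] xs1 a0n0 axs_gt0 dle h_ge0 Im0.
have n0 : 0 < norm2 a0.
  by rewrite lt_def norm2_ge0 andbT; apply: contra a0n0 => /eqP/norm2_eq0/eqP.
have [al al0 axsE] : exists2 al : R, 0 < al & cdot a0 xs = al%:C%C.
  move: axs_gt0; rewrite ltcE; case: (cdot a0 xs) => u v/= /andP[/eqP-> u0].
  by exists u.
have {}dle : delta * norm2 a0 <= al.
  move: dle; rewrite xs1 mulr1 axsE /cmod/= expr0n/= addr0 sqrtr_sqr.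
  by rewrite gtr0_norm.
set b := cdot xs h; set g := h - b *: xs.
have hE : cdot a0 h = cdot a0 g + b * al%:C%C.
  by rewrite -axsE -cdotZr -cdotDr subrK.
have g0 := norm2_ge0 g; have xsg : cdot xs g = 0 by exact: cdot_perp.
split.
- rewrite /Cset/= -norm2_perp_sqr// sqrtr_sqr ger0_norm ?norm2_ge0//.
  rewrite -/g (_ : rinner xs h = complex.Re b)//.
  have s0 : 0 <= Num.sqrt (1 - delta ^+ 2) by exact: sqrtr_ge0.
  have [b0|b0] := leP 0 (complex.Re b).
    by rewrite (@le_trans _ _ 0)// ?oppr_le0 ?mulr_ge0// ltW.
  (* [a1] is the component of [a0] orthogonal to [xs]: it pairs with [g] as [a0] does, and its
     smaller norm supplies the factor [Num.sqrt (1 - delta ^+ 2)]. *)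
  pose a1 := a0 + (- al)%:C%C *: xs.
  have a1g : rinner a1 g = rinner a0 g.
    rewrite rinnerC rinnerDr rinnerZr (rinnerC g xs) [rinner xs g]/rinner xsg.
    by rewrite mulr0 addr0 rinnerC.
  have a1n : norm2 a1 <= Num.sqrt (1 - delta ^+ 2) * norm2 a0.
    rewrite -(@ler_pXn2r _ 2)// ?nnegrE ?mulr_ge0 ?norm2_ge0//.
    rewrite exprMn [Num.sqrt (1 - _) ^+ 2]sqr_sqrtr; last first.
      by rewrite subr_ge0 exprn_ile1 ?ltW.
    rewrite norm2D_sqr norm2Z xs1 rinnerZr [rinner a0 xs]/rinner axsE.
    rewrite /cmod/= expr0n/= addr0 sqrtr_sqr mulr1 real_normK ?num_real// mulr2n.
    have : (delta * norm2 a0) ^+ 2 <= al ^+ 2.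
      by rewrite ler_sqr ?nnegrE// ltW// mulr_gt0.
    by rewrite exprMn; lra.
  have : 0 <= rinner a1 g + complex.Re b * al.
    by move: h_ge0; rewrite a1g /rinner hE ReD ReMc/= mulr0 subr0.
  have := rinner_le a1 g => gle hge.
  rewrite -(ler_pM2l n0).
  have : norm2 a1 * norm2 g <= Num.sqrt (1 - delta ^+ 2) * norm2 a0 * norm2 g.
    by rewrite ler_wpM2r.
  have : al * complex.Re b <= delta * norm2 a0 * complex.Re b.
    by rewrite ler_wnM2r// ltW.
  by lra.
- rewrite /Rset/= -/b -/g -(ler_pM2l n0).
  have := Im_cdot_le a0 g; apply: le_trans.
  have -> : complex.Im (cdot a0 g) = - (complex.Im b * al).
    have := Im0; rewrite hE ImD ImMc/= mulr0 add0r => ?; lra.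
  rewrite normrN normrM (gtr0_norm al0) mulrA mulrC ler_wpM2l//.
  by rewrite mulrC.
Qed.

Lemma solution_Im0 (R : realType) (N M : nat) (a0 : 'cV[R[i]]_N)
    (A : 'I_M -> 'cV[R[i]]_N) (b : 'I_M -> R) (x : 'cV[R[i]]_N) :
  is_solution a0 A b x -> complex.Im (cdot a0 x) = 0.
Proof.
move=> [xfeas xmax]; set z := cdot a0 x.
have z0 : 0 <= cmod z by exact: sqrtr_ge0.
have [//|Imz] := eqVneq (complex.Im z) 0.
have zgt0 : 0 < cmod z.
  rewrite /cmod sqrtr_gt0 ltr_wpDl ?sqr_ge0// lt_def sqr_ge0 andbT.
  by rewrite sqrf_eq0.
(* rotating the phase of x keeps it feasible and makes <a0, x> equal to |z| *)
pose u := Num.conj z * (cmod z)^-1%:C%C.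
have u1 : cmod u ^+ 2 = 1.
  rewrite cmod_sqr ReMc ImMc Re_conj Im_conj/= !mulr0 subr0 add0r.
  rewrite !exprMn sqrrN -mulrDl -cmod_sqr -exprMn.
  by rewrite divff ?expr1n// gt_eqF.
have cmodM (c e : R[i]) : cmod (c * e) ^+ 2 = cmod c ^+ 2 * cmod e ^+ 2.
  by rewrite !cmod_sqr ReMc ImMc; ring.
have /xmax : feasible A b (u *: x).
  by move=> i; rewrite cdotZr cmodM u1 mul1r; exact: xfeas.
rewrite /rinner cdotZr -/z => zle.
have uz : complex.Re (u * z) = cmod z.
  have zn0 : cmod z != 0 by rewrite gt_eqF.
  apply: (mulfI zn0).
  rewrite !ReMc ImMc Re_conj Im_conj/= !mulr0 subr0 add0r -expr2 cmod_sqr.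
  by field; rewrite gt_eqF.
have := zle; rewrite uz leNgt => /negP; case.
rewrite (le_lt_trans (ler_norm _))// -sqrtr_sqr /cmod ltr_sqrt.
  by rewrite ltrDl lt_def sqr_ge0 sqrf_eq0 Imz.
by rewrite ltr_wpDl ?sqr_ge0// lt_def sqr_ge0 sqrf_eq0 Imz.
Qed.

(** Nonnegative noise makes [xs] feasible, so optimality gives [0 <= rinner a0 h] for the error [h].
    Expanding the constraint at [xs + h] and dropping the square of [cdot (A i) h] leaves twice the
    inner product bounded by the noise. *)
Lemma solution_error (R : realType) (N M : nat) (delta c : R)
    (xs a0 xhat : 'cV[R[i]]_N) (A : 'I_M -> 'cV[R[i]]_N) (xi : 'I_M -> R) :
  0 < delta < 1 -> norm2 xs = 1 -> a0 != 0 -> 0 < cdot a0 xs ->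
  delta * norm2 a0 * norm2 xs <= cmod (cdot a0 xs) ->
  (forall i, 0 <= xi i <= c) ->
  is_solution a0 A (fun i => cmod (cdot (A i) xs) ^+ 2 + xi i) xhat ->
  [/\ Cset delta xs (xhat - xs), Rset delta xs (xhat - xs) &
      forall i, rinner (A i *m (adj (A i) *m xs)) (xhat - xs) <= 2^-1 * c].
Proof.
move=> d01 xs1 a0n0 axs_gt0 dle xic sol.
have Im0 := solution_Im0 sol; have [xfeas xmax] := sol.
set h := xhat - xs; have xE : xhat = xs + h by rewrite addrC subrK.
have hge0 : 0 <= rinner a0 h.
  have : rinner a0 xs <= rinner a0 xhat.
    by apply: xmax => i; rewrite lerDl; case/andP: (xic i).
  by rewrite xE rinnerDr lerDl.
have Imh0 : complex.Im (cdot a0 h) = 0.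
  move: Im0; rewrite xE cdotDr ImD; move: axs_gt0; rewrite ltcE.
  by move=> /andP[/eqP-> _]; rewrite add0r.
have [Ch Rh] := error_in_cones d01 xs1 a0n0 axs_gt0 dle hge0 Imh0.
split=> // i; have := xfeas i; rewrite xE cmod_cdotD_sqr.
have := sqr_ge0 (cmod (cdot (A i) h)); case/andP: (xic i); lra.
Qed.

(** * Passage to the random measurements *)

Local Open Scope classical_set_scope.

Definition pointed_vec (R : realType) (N : nat) : pointedType :=
  HB.pack 'cV[R[i]]_N (isPointed.Build 'cV[R[i]]_N 0).

(** The generators of [vec_sets], restated on the pointed type so that measurability in
    [measurable_vec] unfolds to [vec_sets]. *)
Definition vec_generators (R : realType) (N : nat) : set (set (pointed_vec R N)) :=
  [set S | exists k : 'I_N, exists B : set R, measurable B /\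
    (S = (fun v : 'cV[R[i]]_N => complex.Re (v k 0)) @^-1` B \/
     S = (fun v : 'cV[R[i]]_N => complex.Im (v k 0)) @^-1` B)].

(* C^N as a measurable type, with vec_sets as sigma-algebra. *)
Definition measurable_vec (R : realType) (N : nat) :=
  g_sigma_algebraType (@vec_generators R N).

(** * Measurability of the half-space events *)

Lemma measurable_Re_coord (R : realType) (N : nat) (k : 'I_N) :
  measurable_fun setT (fun v : measurable_vec R N => complex.Re (v k 0) : R).
Proof.
move=> _ B mB; rewrite setTI; apply: sub_sigma_algebra.
by exists k, B; split=> //; left.
Qed.

Lemma measurable_Im_coord (R : realType) (N : nat) (k : 'I_N) :
  measurable_fun setT (fun v : measurable_vec R N => complex.Im (v k 0) : R).
Proof.
move=> _ B mB; rewrite setTI; apply: sub_sigma_algebra.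
by exists k, B; split=> //; right.
Qed.

Lemma measurable_Re_cdot (R : realType) (N : nat) (y : 'cV[R[i]]_N) :
  measurable_fun setT (fun v : measurable_vec R N => complex.Re (cdot v y) : R).
Proof.
under eq_fun do rewrite -[complex.Re _]/(rinner _ _) rinnerE.
apply: measurable_sum => k; apply: measurable_funD; apply: measurable_funM => //.
  exact: measurable_Re_coord.
exact: measurable_Im_coord.
Qed.

Lemma measurable_Im_cdot (R : realType) (N : nat) (y : 'cV[R[i]]_N) :
  measurable_fun setT (fun v : measurable_vec R N => complex.Im (cdot v y) : R).
Proof.
under eq_fun do rewrite cdotE Im_sum.
apply: measurable_sum => k.
under eq_fun do rewrite ImMc Re_conj Im_conj mulNr.
apply: measurable_funB; apply: measurable_funM => //.
  exact: measurable_Re_coord.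
exact: measurable_Im_coord.
Qed.

Lemma vec_sets_measurement_le (R : realType) (N : nat) (x h : 'cV[R[i]]_N) (c : R) :
  vec_sets [set v : 'cV[R[i]]_N | rinner (v *m (adj v *m x)) h <= c].
Proof.
have mf : measurable_fun setT
    (fun v : measurable_vec R N => rinner (v *m (adj v *m x)) h : R).
  under eq_fun do rewrite rinner_measurement ReMc Re_conj Im_conj mulNr opprK.
  apply: measurable_funD; apply: measurable_funM.
  - exact: measurable_Re_cdot.
  - exact: measurable_Re_cdot.
  - exact: measurable_Im_cdot.
  - exact: measurable_Im_cdot.
have : measurable [set v : measurable_vec R N | rinner (v *m (adj v *m x)) h <= c].
  have := mf measurableT `]-oo, c]%classic (measurable_itv _).
  by rewrite setTI; congr (measurable _); apply/seteqP; split=> v /=; rewrite in_itv.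
exact.
Qed.

(** Finite additivity over the fibres of [X]; [S] carries no sigma-algebra, so measurability is
    asked of each fibre. *)
Lemma fin_law_sum (R : realType) d (T : measurableType d) (P : probability T R)
    (S : finType) (X : T -> S) (Q : pred S) :
  (forall s, measurable (X @^-1` [set s])) ->
  measurable (X @^-1` [set s | Q s]) /\
  P (X @^-1` [set s | Q s]) = (\sum_(s | Q s) fine (P (X @^-1` [set s])))%:E.
Proof.
move=> mX; have H (r : seq S) : uniq r -> measurable (X @^-1` [set s | s \in r]) /\
    P (X @^-1` [set s | s \in r]) = (\sum_(s <- r) fine (P (X @^-1` [set s])))%:E.
  elim: r => [_|s r IHr /= /andP[sr /IHr[mr Pr]]].
    rewrite big_nil (_ : _ @^-1` _ = set0) ?measure0//.
    by apply/seteqP; split.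
  have -> : X @^-1` [set s' | s' \in s :: r] =
      X @^-1` [set s] `|` X @^-1` [set s | s \in r].
    apply/seteqP; split=> w /=; rewrite inE.
      by move=> /orP[/eqP|]; [left|right].
    by move=> [->|->]; rewrite ?eqxx ?orbT.
  split; first exact: measurableU.
  rewrite measureU//; last first.
    by apply/seteqP; split=> w //= [->]; exact/negP.
  by rewrite big_cons EFinD -Pr fineK// fin_num_measure.
have QE : [set s | Q s] = [set s | s \in [seq s <- enum S | Q s]].
  by apply/seteqP; split=> s /=; rewrite mem_filter mem_enum andbT.
have [mQ PQ] := H [seq s <- enum S | Q s] (filter_uniq _ (enum_uniq _)).
by rewrite QE; split=> //; rewrite PQ big_filter big_enum_cond.
Qed.

(** The identification of C^N with R^(2N); its dimension [N + N] is the one entering the shattering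
    bound. *)
Definition coords (R : realType) (N : nat) (x : 'cV[R[i]]_N) : 'rV[R]_(N + N) :=
  row_mx (\row_k complex.Re (x k 0)) (\row_k complex.Im (x k 0)).

Lemma rinner_coords (R : realType) (N : nat) (x y : 'cV[R[i]]_N) :
  rinner x y = (coords x *m (coords y)^T) 0 0.
Proof.
rewrite /coords tr_row_mx mul_row_col !mxE -big_split rinnerE.
by apply: eq_bigr => k _; rewrite !mxE.
Qed.

(** The pattern [phi v] of half-spaces missed by [v] takes finitely many values, and by independence
    the patterns of the sample follow the product of its law [mu]. Double sampling then applies,
    with [Q] the trace bound for 2M points in dimension [N + N]. *)
Lemma finite_family_bound (R : realType) d (T : measurableType d)
    (P : probability T R) (N M : nat) (J : finType) (xs : 'cV[R[i]]_N)
    (a : T -> 'cV[R[i]]_N) (A : 'I_M -> T -> 'cV[R[i]]_N) (h : J -> 'cV[R[i]]_N)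
    (c p th : R) :
  0 <= c -> 0 <= p -> 0 < th <= 1 ->
  random_vec a -> (forall i, random_vec (A i)) ->
  (forall i, same_law P (A i) a) -> mutually_indep P A ->
  (forall j, (p%:E <= P [set w | (c < rinner (a w *m (adj (a w) *m xs)) (h j))%R])%E) ->
  let B := [set w | exists j, forall i,
                      rinner (A i w *m (adj (A i w) *m xs)) (h j) <= c] in
  measurable B /\
  (P B <= ((1 + th) ^+ (M * 2) / th ^+ (N + N) / (1 + p) ^+ M)%:E)%E.
Proof.
move=> c0 p0 /[dup] th01 /andP[th0 _] ma mA lawA indA pP B.
pose f v j := rinner (v *m (adj v *m xs)) (h j) <= c.
pose phi v := [set j | f v j]%SET.
have vphi (s : {set J}) : vec_sets (phi @^-1` [set s]).
  have -> : phi @^-1` [set s] =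
      \bigcap_(j in [set: J]) (if j \in s then [set v | f v j] else ~` [set v | f v j]).
    apply/seteqP; split=> v /=.
      by move=> <- j _; rewrite inE; case: ifP => //= ->.
    move=> H; apply/finset.setP => j; rewrite inE; have := H j I.
    by case: ifP => //= _ /negP/negbTE.
  apply: (@fin_bigcap_measurable _ (measurable_vec R N)) => // j _.
  have mfj : measurable ([set v | f v j] : set (measurable_vec R N)).
    exact: vec_sets_measurement_le.
  by case: ifP => _ //; exact: (measurableC mfj).
pose mu s := fine (P (a @^-1` (phi @^-1` [set s]))).
have mphi s : measurable ((phi \o a) @^-1` [set s]).
  exact: (ma (phi @^-1` [set s])).
have mu0 s : 0 <= mu s by rewrite fine_ge0.
have mu1 : \sum_s mu s = 1.
  have [_] := fin_law_sum P xpredT mphi; rewrite (_ : _ @^-1` _ = setT).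
    by rewrite probability_setT => -[<-].
  by apply/seteqP; split.
have pmu (j : J) : p <= \sum_(s : {set J} | j \notin s) mu s.
  have [_] := fin_law_sum P (fun s : {set J} => j \notin s) mphi.
  rewrite -lee_fin => <-; apply: le_trans (pP j) _.
  rewrite le_eqVlt; apply/orP; left; apply/eqP; congr (P _).
  by apply/seteqP; split=> w /=; rewrite inE ltNge.
pose Y w := [ffun i => phi (A i w)].
have YE (s : {ffun 'I_M -> {set J}}) : Y @^-1` [set s] =
    \bigcap_(i in [set i | i \in [set: 'I_M]%SET]) (A i @^-1` (phi @^-1` [set s i])).
  apply/seteqP; split=> w /=.
    by move=> <- i _; rewrite /= ffunE.
  by move=> H; apply/ffunP => i; rewrite ffunE; apply: H; rewrite /= inE.
have mY s : measurable (Y @^-1` [set s]).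
  by rewrite YE; apply: fin_bigcap_measurable => // i _; exact: (mA i _ (vphi _)).
have PY s : fine (P (Y @^-1` [set s])) = \prod_i mu (s i).
  rewrite YE indA//.
  have -> : (\prod_(i in [set: 'I_M]%SET) P (A i @^-1` (phi @^-1` [set s i])) =
     (\prod_i mu (s i))%:E)%E; last by [].
  rewrite -prodEFin; apply: eq_big => [i|i _]; first by rewrite inE.
  by rewrite lawA// fineK// fin_num_measure//; exact: (ma _ (vphi _)).
pose bad (s : {ffun 'I_M -> {set J}}) := [exists j, forall i, j \in (s i : {set J})].
have BE : B = Y @^-1` [set s | bad s].
  apply/seteqP; split=> w /=.
    move=> [j jw]; apply/existsP; exists j; apply/forallP => i.
    by rewrite ffunE inE; exact: jw.
  move=> /existsP[j /forallP jw]; exists j => i.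
  by have := jw i; rewrite ffunE inE.
have [mB PB] := fin_law_sum P bad mY.
rewrite BE; split=> //; rewrite PB lee_fin.
rewrite (eq_bigr _ (fun s _ => PY s)) ler_pdivlMr ?exprn_gt0//; last by rewrite ltr_pwDl.
rewrite mulrC; apply: double_sample_bound => // z zpos.
(* Patterns of positive mass are attained by actual vectors, so the traces are cut out by genuine
   half-spaces. *)
have [v vz] : exists v : 'I_M * bool -> 'cV[R[i]]_N, forall i, phi (v i) = z i.
  have : forall i, exists v, phi v = z i; last exact: fin_all_exists.
  move=> i; apply: contrapT => nov.
  have := zpos i; rewrite /mu (_ : _ @^-1` _ = set0) ?measure0 ?ltxx//.
  by apply/seteqP; split=> // w /= aw; apply: nov; exists (a w).
rewrite ler_pdivlMr ?exprn_gt0// mulrC.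
have := @card_family_le R _ (traces z) (N + N) th th01.
rewrite card_prod card_ord card_bool; apply=> D.
have -> : traces z = [set [set i | (coords (v i *m (adj (v i) *m xs)) *m
    (coords (h j))^T) 0 0 <= c]%SET | j : J]%SET.
  apply: eq_imset => j; apply/finset.setP => i.
  by rewrite !inE -vz inE /f rinner_coords.
exact: shattered_halfspaces.
Qed.

(** One point of [G] is chosen in each rational box that meets [G]; [y0] serves the empty boxes and
    the invalid codes. *)
Lemma countable_dense (R : realType) (V : Type) (D : nat) (co : V -> 'rV[R]_D)
    (G : set V) : G !=set0 ->
  exists g : nat -> V, (forall n, G (g n)) /\
    forall x e, G x -> 0 < e -> exists n, forall k, `|co (g n) 0 k - co x 0 k| < e.
Proof.
move=> [y0 Gy0].
pose near (q : 'rV[rat]_D * rat) y :=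
  G y /\ forall k, `|co y 0 k - ratr (q.1 0 k)| < ratr q.2.
have pick q : exists y, G y /\ ((exists y', near q y') -> near q y).
  have [[y qy]|noy] := pselect (exists y', near q y').
    by exists y; split=> //; case: qy.
  by exists y0.
pose g n := if @unpickle ('rV[rat]_D * rat)%type n is Some q
            then sval (cid (pick q)) else y0.
exists g; split=> [n|x e Gx e0].
  by rewrite /g; case: unpickle => // q; case: (svalP (cid (pick q))).
(* Both [x] and the chosen point lie within [r < e / 2] of the rational centre. *)
have e20 : 0 < e / 2 by rewrite divr_gt0.
have [r] := rat_in_itvoo e20; rewrite in_itv/= => /andP[r0 re].
have xq k : exists q : rat, `|co x 0 k - ratr q| < ratr r.
  have [|q] := @rat_in_itvoo R (co x 0 k - ratr r) (co x 0 k + ratr r).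
    by lra.
  by rewrite in_itv/= => /andP[q1 q2]; exists q; rewrite ltr_norml; lra.
have [q qP] := fin_all_exists xq.
pose Q : 'rV[rat]_D * rat := (\row_k q k, r).
exists (pickle Q) => k; rewrite /g pickleK.
have [_ []] := svalP (cid (pick Q)).
  by exists x; split=> // i; rewrite /= mxE.
set y := sval _ => _ /(_ k); rewrite /= mxE => yk.
have := qP k; move: yk; rewrite !ltr_norml => /andP[? ?] /andP[? ?].
by lra.
Qed.

Lemma rinner_sub_coords (R : realType) (N : nat) (y x z : 'cV[R[i]]_N) (e : R) :
  (forall k, `|coords x 0 k - coords z 0 k| < e) ->
  rinner y x <= rinner y z + (\sum_k `|coords y 0 k|) * e.
Proof.
move=> xze; rewrite !rinner_coords ![(_ *m _) 0 0]mxE mulr_suml -big_split/=.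
rewrite ler_sum// => k _; rewrite ![(coords _)^T _ _]mxE -lerBlDl -mulrBr.
rewrite (le_trans (ler_norm _))// normrM ler_wpM2l//.
exact: ltW.
Qed.

(** The events for the first members of a dense sequence increase, so their common bound passes to
    the union. Strict inequalities at finitely many [i] survive a small move of [h] to a member of
    the sequence. *)
Lemma family_bound (R : realType) d (T : measurableType d)
    (P : probability T R) (N M : nat) (xs : 'cV[R[i]]_N)
    (a : T -> 'cV[R[i]]_N) (A : 'I_M -> T -> 'cV[R[i]]_N) (G : set 'cV[R[i]]_N)
    (c p th : R) :
  0 <= c -> 0 <= p -> 0 < th <= 1 ->
  random_vec a -> (forall i, random_vec (A i)) ->
  (forall i, same_law P (A i) a) -> mutually_indep P A ->
  (forall h, G h ->
     (p%:E <= P [set w | (c < rinner (a w *m (adj (a w) *m xs)) h)%R])%E) ->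
  exists B : set T, [/\ measurable B,
    (P B <= ((1 + th) ^+ (M * 2) / th ^+ (N + N) / (1 + p) ^+ M)%:E)%E &
    forall w h, G h ->
      (forall i, rinner (A i w *m (adj (A i w) *m xs)) h < c) -> B w].
Proof.
move=> c0 p0 th01 ma mA lawA indA GP.
have [G0|nG0] := pselect (G !=set0); last first.
  exists set0; split=> // [|w h Gh]; last by case: nG0; exists h.
  have /andP[/ltW th0 _] := th01.
  by rewrite measure0 lee_fin !divr_ge0 ?exprn_ge0 ?addr_ge0.
have [g [Gg gdense]] := countable_dense (@coords R N) G0.
pose B n := [set w | exists j : 'I_n.+1, forall i,
  rinner (A i w *m (adj (A i w) *m xs)) (g j) <= c].
have H n := @finite_family_bound R d T P N M 'I_n.+1 xs a A (fun j => g j) c p th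
  c0 p0 th01 ma mA lawA indA (fun j => GP _ (Gg j)).
have mB n : measurable (B n) by have [] := H n.
have mU : measurable (\bigcup_n B n) by exact: bigcup_measurable.
exists (\bigcup_n B n); split=> // [|w h Gh hlt].
  have ndB : nondecreasing_seq B.
    move=> n m nm; apply/subsetPset => w [j jw].
    have lejm : (j < m.+1)%N by rewrite (leq_trans (ltn_ord j)).
    by exists (Ordinal lejm).
  apply: cvge_le (nondecreasing_cvg_mu mB mU ndB).
  by apply: nearW => n; have [] := H n.
pose S i := \sum_k `|coords (A i w *m (adj (A i w) *m xs)) 0 k|.
have S0 i : 0 <= S i by exact: sumr_ge0.
pose f i := rinner (A i w *m (adj (A i w) *m xs)) h.
have fc i : 0 < c - f i by rewrite subr_gt0; exact: hlt.
have SS i : 0 < 1 + S i by rewrite ltr_pwDl.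
(* Capping at 1 makes the product of the [m i] positive and at most each factor; the denominator
   [1 + S i] avoids dividing by zero. *)
pose m i := Num.min 1 ((c - f i) / (1 + S i)).
have m0 i : 0 < m i by rewrite lt_min ltr01 divr_gt0.
have [e e0 eP] : exists2 e, 0 < e & forall i, f i + S i * e <= c.
  exists (\prod_i m i); first by apply: prodr_gt0.
  move=> i; rewrite -lerBrDl (bigD1 i)//=.
  have /andP[q0 q1] : 0 <= \prod_(j < M | j != i) m j <= 1.
    apply/andP; split; first by apply: prodr_ge0 => j _; exact: ltW.
    by apply: prodr_ile1 => j _; rewrite ltW// ge_min lexx.
  apply: (@le_trans _ _ (S i * ((c - f i) / (1 + S i)))).
    rewrite ler_wpM2l// (@le_trans _ _ (m i))//; last by rewrite ge_min lexx orbT.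
    by rewrite ler_piMr// ltW.
  by rewrite mulrA ler_pdivrMr// mulrC ler_wpM2l ?lerDr// ltW.
have [n nP] := gdense h e Gh e0.
exists n => //; exists ord_max => i.
by rewrite (le_trans (rinner_sub_coords _ nP))// eP.
Qed.

(** * Sample size *)

(** At [th = p / 8] the number of traces costs [2 * N * ln (8 / p)], to be paid from the remaining
    decay [M / 2 * ln (1 + p)]; hence the factor 4. *)
Definition sample_constant (R : realType) (p : R) : R := 4 * (ln (8 / p) / ln (1 + p)).

(** Makes [2 * ln (8 / p)] exceed 1, so that the same constant also absorbs the [ln eps^-1] term. *)
Lemma ln_8div_gt (R : realType) (p : R) : 0 < p < 1 -> 2^-1 < ln (8 / p).
Proof.
move=> /andP[p0 p1]; rewrite -[8 / p]invrK lnV ?posrE ?invr_gt0 ?divr_gt0//.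
rewrite invf_div; have /le_ln1Dx : -1 < p / 8 - 1 by lra.
by rewrite addrC subrK => ?; lra.
Qed.

Lemma ln1D_gt0 (R : realType) (p : R) : 0 < p -> 0 < ln (1 + p).
Proof. by move=> p0; rewrite ln_gt0// ltrDl. Qed.

Lemma sample_constant_gt0 (R : realType) (p : R) : 0 < p < 1 -> 0 < sample_constant p.
Proof.
move=> /[dup] p01 /andP[p0 _]; have := ln_8div_gt p01 => ?.
by rewrite mulr_gt0// divr_gt0 ?ln1D_gt0//; lra.
Qed.

Lemma sample_constant_decr (R : realType) (p q : R) :
  0 < p < 1 -> 0 < q < 1 -> p < q -> sample_constant q < sample_constant p.
Proof.
move=> p01 q01 pq; have /andP[p0 _] := p01; have /andP[q0 _] := q01.
have Lp := ln_8div_gt p01; have Lq := ln_8div_gt q01.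
rewrite /sample_constant ltr_pM2l// ltr_pM//.
- lra.
- by rewrite invr_ge0 ltW ?ln1D_gt0.
- by rewrite ltr_ln ?posrE ?divr_gt0// ltr_pM2l// ltf_pV2 ?posrE.
- rewrite ltf_pV2 ?posrE ?ln1D_gt0// ltr_ln ?posrE ?addr_gt0//; lra.
Qed.

(* With th = p / 8 one has (1 + th)^4 <= 1 + p, so that half of the exponential
   decay (1 + p)^-M survives the factor (1 + th)^(2 M). *)
Lemma sample_size_bound (R : realType) (p eps : R) (N M : nat) :
  0 < p < 1 -> 0 < eps < 1 ->
  sample_constant p * (N%:R + ln eps^-1) <= M%:R ->
  (1 + p / 8) ^+ (M * 2) / (p / 8) ^+ (N + N) / (1 + p) ^+ M <= eps.
Proof.
move=> /[dup] p01 /andP[p0 p1] /andP[e0 e1] MC.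
have th0 : 0 < p / 8 by rewrite divr_gt0.
have t1 : 0 < 1 + p / 8 by rewrite addr_gt0.
have p1' : 0 < 1 + p by rewrite addr_gt0.
have L2 := ln_8div_gt p01; have x0 := ln1D_gt0 p0.
rewrite -ler_ln ?posrE ?divr_gt0 ?exprn_gt0//.
rewrite ln_div ?posrE ?divr_gt0 ?exprn_gt0// ln_div ?posrE ?exprn_gt0//.
rewrite !lnXn// -(mulr_natr _ (M * 2)) -(mulr_natr _ (N + N)) -(mulr_natr _ M).
rewrite natrM natrD.
have -> : ln (p / 8) = - ln (8 / p) by rewrite -lnV ?posrE ?divr_gt0// invf_div.
have t4 : 4 * ln (1 + p / 8) <= ln (1 + p).
  rewrite mulrC mulr_natr -lnXn// ler_ln ?posrE ?exprn_gt0//.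
  by nra.
have el : 0 < ln eps^-1 by rewrite ln_gt0// invf_gt1.
have -> : ln eps = - ln eps^-1 by rewrite lnV ?posrE ?opprK.
have {}MC : 4 * ln (8 / p) * (N%:R + ln eps^-1) <= M%:R * ln (1 + p).
  by rewrite -ler_pdivrMr// mulrAC; move: MC; rewrite /sample_constant !mulrA mulrAC.
have M0 : 0 <= M%:R :> R by [].
have := ler_wpM2r M0 t4.
have : ln eps^-1 <= 2 * ln (8 / p) * ln eps^-1.
  by rewrite ler_peMl ?ltW//; lra.
lra.
Qed.

(** * Scaling inside the cones and conclusion *)

Lemma cones_scale (R : realType) (N : nat) (delta s : R) (xs h : 'cV[R[i]]_N) :
  norm2 xs = 1 -> 0 < s -> Cset delta xs h -> Rset delta xs h ->
  Cset delta xs (s%:C%C *: h) /\ Rset delta xs (s%:C%C *: h).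
Proof.
move=> xs1 s0; rewrite /Cset /Rset /= -!norm2_perp_sqr// !sqrtr_sqr.
have cs : cmod s%:C%C = s.
  by rewrite /cmod/= expr0n/= addr0 sqrtr_sqr gtr0_norm.
rewrite !(ger0_norm (norm2_ge0 _)) cdotZr -scalerA -scalerBr norm2Z cs rinnerZr.
move=> Ch Rh; split.
  by rewrite !(mulrCA _ s) -mulrN ler_pM2l.
by rewrite ImMc/= mul0r addr0 normrM gtr0_norm// mulrCA ler_pM2l.
Qed.

Theorem theorem1 (R : realType) :
  exists C : R -> R,
    (forall p, 0 < p < 1 -> 0 < C p) /\
    (forall p q, 0 < p < 1 -> 0 < q < 1 -> p < q -> C q < C p) /\
  forall (pmin : R), 0 < pmin < 1 ->
  forall (delta eta t : R), 0 < delta < 1 -> 0 < eta -> 0 < t ->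
  forall (N : nat) (xs a0 : 'cV[R[i]]_N),
    norm2 xs = 1 ->
    a0 != 0 ->
    0 < cdot a0 xs ->
    delta * norm2 a0 * norm2 xs <= cmod (cdot a0 xs) ->
  forall (d : measure_display) (T : measurableType d) (P : probability T R)
         (a : T -> 'cV[R[i]]_N),
    random_vec a ->
    (forall h, Cset delta xs h -> Rset delta xs h -> (t * eta)^-1 < norm2 h ->
       (pmin%:E <= P [set w | (2^-1 * eta^-1 <
                     rinner (a w *m (adj (a w) *m xs)) h)%R])%E) ->
  forall (M : nat) (eps : R), 0 < eps < 1 ->
    C pmin * (N%:R + ln (eps^-1)) <= M%:R ->
  forall (A : 'I_M -> T -> 'cV[R[i]]_N),
    (forall i, random_vec (A i)) ->
    (forall i, same_law P (A i) a) ->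
    mutually_indep P A ->
  forall (xi : 'I_M -> T -> R),
    (forall i w, 0 <= xi i w <= eta^-1) ->
  exists E : set T, measurable E /\ ((1 - eps)%:E <= P E)%E /\
    forall w, E w ->
    forall xhat : 'cV[R[i]]_N,
      is_solution a0 (fun i => A i w)
        (fun i => cmod (cdot (A i w) xs) ^+ 2 + xi i w) xhat ->
      norm2 (xhat - xs) <= (t * eta)^-1.
Proof.
exists (@sample_constant R); split; first exact: sample_constant_gt0.
split; first exact: sample_constant_decr.
move=> pmin p01 delta eta t d01 eta0 t0 N xs a0 xs1 a0n0 axs dle d T P a ma small.
move=> M eps eps01 MC A mA lawA indA xi xiP.
have /andP[p0 p1] := p01; set c : R := 2^-1 * eta^-1.
have c0 : 0 < c by rewrite mulr_gt0 ?invr_gt0.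
have r0 : 0 < (t * eta)^-1 by rewrite invr_gt0 mulr_gt0.
pose G := [set h | Cset delta xs h /\ Rset delta xs h /\ (t * eta)^-1 < norm2 h].
have th01 : 0 < pmin / 8 <= 1 by lra.
have [B [mB PB HB]] := family_bound (G := G) (ltW c0) (ltW p0) th01 ma mA lawA indA
  (fun h Gh => small h Gh.1 Gh.2.1 Gh.2.2).
(* [B] is built from the measurements alone and covers every direction in [G], so one event serves
   all solutions at once. *)
exists (~` B); split; first exact: measurableC.
split.
  rewrite probability_setC// EFinB leeB// (le_trans PB)// lee_fin.
  exact: sample_size_bound.
move=> w nBw xhat sol; rewrite leNgt; apply/negP => lth; apply: nBw.
have [Ch Rh hle] := solution_error d01 xs1 a0n0 axs dle (fun i => xiP i w) sol.
set h := xhat - xs in lth Ch Rh hle.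
(* Shrinking h slightly stays in the cones and makes all constraints strict,
   so that h can be approximated from a countable dense family. *)
have h0 : 0 < norm2 h by exact: lt_trans lth.
(* The midpoint between 1 and the ratio at which [h] would shrink to norm [(t * eta)^-1], so the
   scaled error still exceeds that radius. *)
pose s := ((t * eta)^-1 / norm2 h + 1) / 2.
have s0 : 0 < s by rewrite divr_gt0 ?addr_gt0 ?divr_gt0.
have s1 : s < 1.
  by rewrite /s ltr_pdivrMr// mul1r; have : (t * eta)^-1 / norm2 h < 1;
     [rewrite ltr_pdivrMr// mul1r|lra].
have [Csh Rsh] := cones_scale xs1 s0 Ch Rh.
apply: (HB w (s%:C%C *: h)) => [|i].
  split=> //; split=> //; rewrite norm2Z /cmod/= expr0n/= addr0 sqrtr_sqr gtr0_norm//.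
  rewrite /s mulrAC mulrDl mul1r divfK ?gt_eqF// ltr_pdivlMr//; lra.
rewrite rinnerZr (@le_lt_trans _ _ (s * c))//; first by rewrite ler_pM2l.
by rewrite gtr_pMl.
Qed.
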